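(* Let $R=\mathbb{Q}[x_1,\dots,x_6]$ and $$I_\Delta=(x_1x_2x_3,\ x_1x_2x_4,\ x_1x_3x_5,\ x_1x_4x_6,\ x_1x_5x_6,\ x_2x_3x_6,\ x_2x_4x_5,\ x_2x_5x_6,\ x_3x_4x_5,\ x_3x_4x_6)\subset R.$$ There is no basic double G-link of the form $I_\Delta=fB+A$ for any squarefree monomial ideal $B$; that is, there do not exist a homogeneous form $f\in R$, a homogeneous ideal $A\subset R$, and a squarefree monomial ideal $B\subset R$ such that $I_\Delta=fB+A$ is a basic double G-link of $B$ on $A$.
   Context: Basic double G-link (in a standard graded polynomial ring $S$ over a field): all ideals are assumed proper, homogeneous, and saturated with respect to the ideal generated by the variables. An ideal is unmixed if all its associated primes have the same height. $S/A$ is generically Gorenstein if $(S/A)_P$ is Gorenstein for all minimal primes $P$ of $A$. Let $A\subset B$ be unmixed ideals of $S$ such that $S/A$ is Cohen--Macaulay and generically Gorenstein and $\operatorname{ht}(A)+1=\operatorname{ht}(B)$. Let $f\in S$ be homogeneous of degree $d>0$ with $A:f=A$. Then $C=fB+A$ is called a basic double G-link of degree $d$ of $B$ on $A$; the equation $C=fB+A$ is also called a basic double G-link. *)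

(* Defs.v *)
From HB Require Import structures.
From mathcomp Require Import all_boot all_order all_algebra.
From mathcomp Require Export mpoly.

Set Implicit Arguments.
Unset Strict Implicit.
Unset Printing Implicit Defensive.

Import GRing.Theory.

Local Open Scope ring_scope.
Local Open Scope quotient_scope.

(* Ideals are the [idealr]s of mathcomp's ring_quotient: these are proper by
   definition, and membership is boolean, which is no restriction in the
   presence of classical axioms.  Two ideals are compared extensionally, by
   [=i].  Heights and depths are relations "the height (depth) is n". *)

Section CommutativeAlgebra.

Variable R : comNzRingType.

Implicit Types (I J M : idealr R) (P Q : prime_idealr R) (s : seq R) (n : nat).

Definition ideal_gen s (x : R) : Prop :=
  exists c : 'I_(size s) -> R, x = \sum_(i < size s) c i * s`_i.

Definition noetherian : Prop :=
  forall I, exists s, forall x, x \in I <-> ideal_gen s x.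

Definition maximal_ideal M : Prop :=
  forall J, {subset M <= J} -> J =i M.

Definition local_ring : Prop :=
  exists2 M, maximal_ideal M & forall N, maximal_ideal N -> N =i M.

Definition prime_chain n P : Prop :=
  exists c : nat -> prime_idealr R, c n =i P /\
    forall i, (i < n)%N ->
      {subset c i <= c i.+1} /\ ~ {subset c i.+1 <= c i}.

Definition prime_height P n : Prop :=
  prime_chain n P /\ forall k, prime_chain k P -> (k <= n)%N.

Definition height I n : Prop :=
  (exists2 P : prime_idealr R, {subset I <= P} & prime_height P n) /\
  (forall P k, {subset I <= P} -> prime_height P k -> (n <= k)%N).

Definition minimal_prime I P : Prop :=
  {subset I <= P} /\
  forall Q, {subset I <= Q} -> {subset Q <= P} -> Q =i P.

Definition associated_prime I P : Prop :=
  exists g, forall x, (x \in P) = (x * g \in I).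

Definition unmixed I : Prop :=
  forall P Q n, associated_prime I P -> associated_prime I Q ->
    prime_height P n -> prime_height Q n.

Definition regular_seq s : Prop :=
  ~ ideal_gen s 1 /\
  forall i, (i < size s)%N -> forall a,
    ideal_gen (take i s) (s`_i * a) -> ideal_gen (take i s) a.

Definition depth I n : Prop :=
  (exists s, [/\ size s = n, {subset s <= I} & regular_seq s]) /\
  (forall s, {subset s <= I} -> regular_seq s -> (size s <= n)%N).

(* Eisenbud, Commutative Algebra, Section 18.2: depth M = codim M for every
   maximal ideal M. *)
Definition cohen_macaulay : Prop :=
  noetherian /\
  forall M, maximal_ideal M -> exists2 n, height M n & depth M n.

Definition injective_module (E : lmodType R) : Prop :=
  forall (M N : lmodType R) (i : {linear M -> N}) (g : {linear M -> E}),
    injective i -> exists h : {linear N -> E}, forall x, h (i x) = g x.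

(* There is an injective resolution
     0 -> R -> E_0 -> E_1 -> E_2 -> ...
   with E_k = 0 for all large k. *)
Definition finite_self_injective_dimension : Prop :=
  exists (E : nat -> lmodType R) (e : {linear R^o -> E 0%N})
         (d : forall k, {linear E k -> E k.+1}),
    [/\ forall k, injective_module (E k),
        injective e,
        forall x, d 0%N x = 0 <-> exists y, x = e y,
        forall k x, d k.+1 x = 0 <-> exists y, x = d k y
      & exists n, forall k, (n < k)%N -> forall x : E k, x = 0].

Definition gorenstein_local : Prop :=
  [/\ noetherian, local_ring & finite_self_injective_dimension].

End CommutativeAlgebra.

(* phi exhibits T as the localization of R at the multiplicative set W; this
   determines T up to a unique isomorphism. *)
Definition is_localization (R T : comNzRingType) (W : R -> Prop)
    (phi : {rmorphism R -> T}) : Prop :=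
  [/\ forall s, W s -> exists t, phi s * t = 1,
      forall t, exists a, exists2 s, W s & t * phi s = phi a
    & forall a, phi a = 0 <-> exists2 s, W s & s * a = 0].

(* The localization (R/A)_P inverts the image of the complement of P. *)
Definition generically_gorenstein (R : comNzRingType) (A : idealr R) : Prop :=
  forall P : prime_idealr R, minimal_prime A P ->
    exists (T : comNzRingType) (phi : {rmorphism {ideal_quot A} -> T}),
      is_localization
        (fun q => exists2 s, s \notin P & q = \pi_{ideal_quot A} s) phi
      /\ gorenstein_local T.

Section PolynomialRing.

Variables (K : fieldType) (n : nat).
Local Notation S := {mpoly K[n]}.

Implicit Types A B : idealr S.

Definition homogeneous_ideal A : Prop :=
  forall p d, p \in A -> pihomog mdeg d p \in A.

(* A : m^oo = A for m = (x_1, ..., x_n); the power m^k is generated by the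
   monomials of degree k. *)
Definition saturated A : Prop :=
  forall p k, (forall m : 'X_{1..n}, mdeg m = k -> 'X_[m] * p \in A) ->
    p \in A.

Definition squarefree (m : 'X_{1..n}) : Prop := forall i, (m i <= 1)%N.

Definition squarefree_monomial_ideal B : Prop :=
  exists2 ms : seq 'X_{1..n}, {in ms, forall m, squarefree m} &
    forall p, p \in B <-> ideal_gen [seq 'X_[m] : S | m <- ms] p.

(* The equation C = fB + A is a basic double G-link of degree d of B on A. *)
Definition basic_double_G_link (d : nat) (C : S -> Prop) (f : S) B A : Prop :=
  [/\ [/\ homogeneous_ideal A, saturated A & unmixed A],
      [/\ homogeneous_ideal B, saturated B & unmixed B],
      [/\ {subset A <= B},
          cohen_macaulay {ideal_quot A},
          generically_gorenstein A
        & exists2 h, height A h & height B h.+1],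
      [/\ (0 < d)%N, f \is d.-homog & forall g, (g * f \in A) = (g \in A)]
    & forall p, C p <-> exists b a, [/\ b \in B, a \in A & p = f * b + a]].

End PolynomialRing.

(* x_i x_j x_k, with the variables numbered from 1 to 6. *)
Definition cubic (i j k : nat) : {mpoly rat[6]} :=
  'X_(inord i.-1) * 'X_(inord j.-1) * 'X_(inord k.-1).

Definition I_Delta : {mpoly rat[6]} -> Prop :=
  ideal_gen
    [:: cubic 1 2 3; cubic 1 2 4; cubic 1 3 5; cubic 1 4 6; cubic 1 5 6;
        cubic 2 3 6; cubic 2 4 5; cubic 2 5 6; cubic 3 4 5; cubic 3 4 6].

(* Main.v *)
(* Suppose I = f B + A is such a link.  As f is a nonzerodivisor modulo A, f is
   not in I, so some monomial mu of f is not in I; by the self-duality of the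
   triangulation some triple of variables generates a prime P containing B
   but not mu.  The ideal A is unmixed of height one less than B, so P is not
   minimal over A, and a chain of primes of length 4 leads from A to the
   irrelevant ideal.  Hence the Cohen-Macaulay ring S/A has depth at least 4, and
   four generic linear forms l_1, ..., l_4 form a regular sequence on it.
   A linear combination p of the ten generators of I is f b + a with b in B and
   a in A.  Every monomial of b of degree 3 - deg f times mu is one of the five
   generators divisible by a fixed variable of mu, so five linear conditions on p
   put p in A.  Modulo the l_i the degree 3 part of S is spanned by the four cubic
   monomials in two variables, so four more conditions put p in (l_1, ..., l_4).
   As 10 > 5 + 4, there is such a nonzero p; by regularity it lies in
   (l_1, ..., l_4) A, which starts in degree 4. *)

Require Import Defs.
From HB Require Import structures.
From mathcomp Require Import all_boot all_order all_algebra.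
From mathcomp Require Import boolp ring.

Set Implicit Arguments.
Unset Strict Implicit.
Unset Printing Implicit Defensive.

Import GRing.Theory.

Local Open Scope ring_scope.
Local Open Scope quotient_scope.

(** * Ideals and noetherian quotients *)

Section Ideals.
Variable R : comNzRingType.
Implicit Types (J A : R -> Prop) (x y z u v w : R) (us zs : seq R).

Definition is_ideal J : Prop :=
  [/\ J 0, forall x y, J x -> J y -> J (x + y) & forall a x, J x -> J (a * x)].

Definition adjoin J y x : Prop := exists a, J (x - a * y).
Definition colon J u x : Prop := J (x * u).
Definition nzd J y : Prop := forall a, J (y * a) -> J a.

Lemma ideal0 J : is_ideal J -> J 0. Proof. by case. Qed.
Lemma idealD J x y : is_ideal J -> J x -> J y -> J (x + y).
Proof. by case=> _ h _; apply: h. Qed.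
Lemma idealM J a x : is_ideal J -> J x -> J (a * x).
Proof. by case=> _ _; apply. Qed.
Lemma idealMl J a x : is_ideal J -> J x -> J (x * a).
Proof. by move=> iJ; rewrite mulrC; apply: idealM. Qed.
Lemma idealN J x : is_ideal J -> J x -> J (- x).
Proof. by move=> iJ Jx; rewrite -mulN1r; apply: idealM. Qed.
Lemma idealB J x y : is_ideal J -> J x -> J y -> J (x - y).
Proof. by move=> iJ Jx Jy; apply: idealD => //; apply: idealN. Qed.
Lemma ideal_subr J x y : is_ideal J -> J (x - y) -> J y -> J x.
Proof. by move=> iJ Jxy Jy; rewrite -(subrK y x); apply: idealD. Qed.
Lemma ideal_sum J (I : Type) (r : seq I) (P : pred I) (F : I -> R) :
  is_ideal J -> (forall i, P i -> J (F i)) -> J (\sum_(i <- r | P i) F i).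
Proof.
move=> iJ JF; elim/big_ind: _ => //; first exact: ideal0.
by move=> x y; apply: idealD.
Qed.

Lemma idealMB J x y x' y' : is_ideal J ->
  J (x - x') -> J (y - y') -> J (x * y - x' * y').
Proof.
move=> iJ Jx Jy; suff -> : x * y - x' * y' = y * (x - x') + x' * (y - y').
  by apply: idealD => //; apply: idealM.
by ring.
Qed.

Lemma adjoin_ideal J y : is_ideal J -> is_ideal (adjoin J y).
Proof.
move=> iJ; split.
- by exists 0; rewrite mul0r subrr; apply: ideal0.
- move=> u v [a Ja] [b Jb]; exists (a + b).
  suff -> : u + v - (a + b) * y = (u - a * y) + (v - b * y) by apply: idealD.
  by ring.
- move=> c u [a Ja]; exists (c * a).
  suff -> : c * u - c * a * y = c * (u - a * y) by apply: idealM.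
  by ring.
Qed.

Lemma sub_adjoin J y x : J x -> adjoin J y x.
Proof. by exists 0; rewrite mul0r subr0. Qed.

Lemma mem_adjoin J y : is_ideal J -> adjoin J y y.
Proof. by move=> iJ; exists 1; rewrite mul1r subrr; apply: ideal0. Qed.

Lemma adjoinC J y z : adjoin (adjoin J y) z = adjoin (adjoin J z) y.
Proof.
suff sub a b x : adjoin (adjoin J a) b x -> adjoin (adjoin J b) a x.
  by apply/funext => x; apply/propext; split; apply: sub.
by move=> [c [d h]]; exists d, c; rewrite addrAC.
Qed.

Lemma colon_ideal J u : is_ideal J -> is_ideal (colon J u).
Proof.
move=> iJ; split; rewrite /colon.
- by rewrite mul0r; apply: ideal0.
- by move=> x y; rewrite mulrDl; apply: idealD.
- by move=> a x; rewrite -mulrA; apply: idealM.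
Qed.

(** A relation y a = b z modulo J puts b in J + (y), say b = c y; cancelling y leaves a = c z. *)
Lemma nzd_swap J y z : is_ideal J -> nzd J y -> nzd (adjoin J y) z -> nzd (adjoin J z) y.
Proof.
move=> iJ Jy Jyz a [b Jab].
have [c Jbc] : adjoin J y b.
  apply: Jyz; exists a; suff -> : z * b - a * y = - (y * a - b * z) by apply: idealN.
  by ring.
exists c; apply: Jy.
suff -> : y * (a - c * z) = (y * a - b * z) + z * (b - c * y).
  by apply: idealD => //; apply: idealM.
by ring.
Qed.

Definition is_prime J : Prop :=
  [/\ is_ideal J, ~ J 1 & forall x y, J (x * y) -> J x \/ J y].

Section ToIdealr.
Variables (J : R -> Prop) (pJ : is_ideal J) (J1 : ~ J 1).

Definition ideal_pred (_ : is_ideal J) (_ : ~ J 1) : R -> bool := fun x => `[< J x >].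

Lemma ideal_pred_closed : idealr_closed (ideal_pred pJ J1 : {pred R}).
Proof.
split=> [||a x y]; rewrite /ideal_pred.
- by apply/asboolP; apply: ideal0.
- by apply/asboolPn.
- move=> /asboolP Jx /asboolP Jy; apply/asboolP.
  by apply: idealD => //; apply: idealM.
Qed.
HB.instance Definition _ := isIdealr.Build R (ideal_pred pJ J1) ideal_pred_closed.

Lemma idealr_of_ideal : exists I : idealr R, forall x, x \in I <-> J x.
Proof. by exists (ideal_pred pJ J1 : idealr R) => x; split; move/asboolP. Qed.

Hypothesis JP : forall x y, J (x * y) -> J x \/ J y.

Definition prime_pred (_ : forall x y, J (x * y) -> J x \/ J y) : R -> bool :=
  ideal_pred pJ J1.
HB.instance Definition _ := Idealr.on (prime_pred JP).
Lemma prime_pred_closed : prime_idealr_closed (prime_pred JP : {pred R}).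
Proof. by move=> x y /asboolP/JP [] h; apply/orP; [left|right]; apply/asboolP. Qed.
HB.instance Definition _ := isPrimeIdealrClosed.Build R (prime_pred JP) prime_pred_closed.
Lemma prime_idealr_of_ideal : exists I : prime_idealr R, forall x, x \in I <-> J x.
Proof. by exists (prime_pred JP : prime_idealr R) => x; split; move/asboolP. Qed.
End ToIdealr.

Lemma idealr_is_ideal (I : idealr R) : is_ideal (fun x => x \in I).
Proof.
split=> [|x y|a x]; [exact: idealr0|exact: rpredD|exact: idealMr].
Qed.

Lemma prime_idealr_is_prime (I : prime_idealr R) : is_prime (fun x => x \in I).
Proof.
split; [exact: idealr_is_ideal | by rewrite idealr1|].
by move=> x y; rewrite prime_idealrM => /orP.
Qed.

(** Noetherianity of R/A as the maximal condition on ideals of R containing A, so that later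
    arguments stay in R. *)
Definition max_principle A : Prop :=
  forall F : (R -> Prop) -> Prop,
    (forall J, F J -> is_ideal J /\ forall x, A x -> J x) ->
  forall J0, F J0 -> exists J,
    [/\ F J, forall x, J0 x -> J x
      & forall J', F J' -> (forall x, J x -> J' x) -> forall x, J' x -> J x].
End Ideals.

Section Quotient.
Variables (R T : comNzRingType) (A : idealr R) (pi : {rmorphism R -> T}).
Hypotheses (pi_surj : forall q, exists x, pi x = q) (pi_ker : forall x, pi x = 0 <-> x \in A).

Definition image (J : R -> Prop) (q : T) : Prop := exists2 x, J x & pi x = q.

Lemma image_pi J x : is_ideal J -> (forall y, y \in A -> J y) -> image J (pi x) <-> J x.
Proof.
move=> iJ AJ; split=> [[y Jy eyx]|Jx]; last by exists x.
apply: (ideal_subr iJ _ Jy); apply/AJ/pi_ker.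
by rewrite rmorphB eyx subrr.
Qed.

Lemma image_ideal J : is_ideal J -> is_ideal (image J).
Proof.
move=> iJ; split.
- by exists 0; rewrite ?rmorph0 //; apply: ideal0.
- by move=> _ _ [x Jx <-] [y Jy <-]; exists (x + y); rewrite ?rmorphD //; apply: idealD.
- move=> a _ [x Jx <-]; have [b <-] := pi_surj a.
  by exists (b * x); rewrite ?rmorphM //; apply: idealM.
Qed.

(** Without a maximal member, dependent choice gives a strictly increasing chain. The image of its
    union is finitely generated, so one member of the chain already contains the union. *)
Lemma noetherian_max_principle : noetherian T -> max_principle (fun x => x \in A).
Proof.
move=> noeT F FI J0 FJ0; apply: contrapT => nomax.
pose S := {J | F J /\ forall x, J0 x -> J x}.
have step (J : S) : {J' : S | (forall x, sval J x -> sval J' x) /\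
    ~ (forall x, sval J' x -> sval J x)}.
  case: J => J [FJ sJ]; apply: cid; apply: contrapT => h.
  apply: nomax; exists J; split=> // J' FJ' JJ' x J'x; apply: contrapT => nJx.
  apply: h; have sJ' : F J' /\ forall x, J0 x -> J' x by split=> // y /sJ/JJ'.
  by exists (exist _ J' sJ') => /=; split => // /(_ x J'x).
pose c k := iter k (fun J => sval (step J)) (exist _ J0 (conj FJ0 (fun x h => h)) : S).
have cS k x : sval (c k) x -> sval (c k.+1) x by case: (svalP (step (c k))) => h _; apply: h.
have cN k : ~ (forall x, sval (c k.+1) x -> sval (c k) x) by case: (svalP (step (c k))).
have cle k l : (k <= l)%N -> forall x, sval (c k) x -> sval (c l) x.
  elim: l => [|l IH]; first by rewrite leqn0 => /eqP ->.
  by rewrite leq_eqVlt => /predU1P[->//|/IH h x /h /cS].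
have ci k : is_ideal (sval (c k)) by case: (c k) => J [FJ sJ]; case: (FI J FJ).
have cA k x : x \in A -> sval (c k) x by case: (c k) => J [FJ sJ]; case: (FI J FJ) => _; apply.
pose U x := exists k, sval (c k) x.
have iU : is_ideal U.
  split; first by exists 0%N; apply: ideal0.
    move=> x y [k hx] [l hy]; exists (maxn k l).
    by apply: idealD => //; [apply: cle hx; rewrite leq_maxl|apply: cle hy; rewrite leq_maxr].
  by move=> a x [k hx]; exists k; apply: idealM.
have UA x : x \in A -> U x by exists 0%N; apply: cA.
(* Each member of the chain is strictly below the next, hence proper; so the union is proper and has
   an [idealr] as its image. *)
have U1 : ~ U 1.
  by case=> k h; apply: (cN k) => x _; rewrite -(mulr1 x); apply: idealM.
have [|I IU] := idealr_of_ideal (image_ideal iU).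
  by rewrite -(rmorph1 pi) image_pi.
have [s sI] := noeT I.
have /fin_all_exists [K Kh] (i : 'I_(size s)) : exists k, image (sval (c k)) s`_i.
  have /IU [y [k hk] <-] : s`_i \in I.
    apply/sI; exists (fun j => (j == i)%:R); rewrite (bigD1 i) //= eqxx mul1r.
    by rewrite big1 ?addr0 // => j /negPf ->; rewrite mul0r.
  by exists k, y.
pose k := \max_i K i; apply: (cN k) => x hx.
have : pi x \in I by apply/IU; exists x => //; exists k.+1.
move=> /sI [a ha]; rewrite -(image_pi x (ci k) (cA k)) ha.
apply: ideal_sum => [|i _]; first exact: image_ideal.
apply: idealM; first exact: image_ideal.
by case: (Kh i) => y hy <-; exists y => //; apply: cle hy; apply: leq_bigmax.
Qed.
End Quotient.

(** * Associated primes and depth *)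

Section AssociatedPrimes.
Variables (R : comNzRingType) (A J : R -> Prop).
Implicit Types (u v : R) (us : seq R).
Hypotheses (mpA : max_principle A) (iJ : is_ideal J) (AJ : forall x, A x -> J x).

Definition max_colon u : Prop :=
  ~ J u /\ forall v, ~ J v -> (forall x, colon J u x -> colon J v x) ->
    forall x, colon J v x -> colon J u x.

Lemma sub_max_colon v : ~ J v ->
  exists2 u, max_colon u & forall x, colon J v x -> colon J u x.
Proof.
move=> nJv; pose F K := exists2 u, ~ J u & K = colon J u.
have [|| K [[u nJu ->] sub max]] := mpA (F := F) _ (J0 := colon J v).
- move=> _ [u _ ->]; split; first exact: colon_ideal.
  by move=> x /AJ Jx; apply: idealMl.
- by exists v.
- exists u => //; split=> // u' nJu' h; apply: max h; by exists u'.
Qed.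

(** If y u is not in J, then J : (y u) contains J : u, hence equals it by maximality, and x lies in
    J : (y u). *)
Lemma max_colon_prime u : max_colon u -> is_prime (colon J u).
Proof.
move=> [nJu max]; split; first exact: colon_ideal.
  by rewrite /colon mul1r.
move=> x y Jxyu; case: (EM (J (y * u))) => [|nJyu]; [by right|left].
apply: (max (y * u) nJyu _ x) => [z Jzu|]; last by rewrite /colon mulrA.
by rewrite /colon mulrCA; apply: idealM.
Qed.

(** Otherwise each v in [us] has a multiplier b with b v in J but b u not in J. By primality the
    product of these b does not carry u into J, although it carries the whole span there. *)
Lemma sub_colon_of_mem_span u us : is_prime (colon J u) ->
  foldr (fun v K => adjoin K v) J us u ->
  exists2 v, v \in us & forall x, colon J v x -> colon J u x.
Proof.
move=> [icu c1 cM] uus; apply: contrapT => h.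
suff [a nJau Ja] : exists2 a, ~ J (a * u) &
    forall w, foldr (fun v K => adjoin K v) J us w -> J (a * w).
  by apply: nJau; apply: Ja.
elim: us h {uus} => [|v us IH] h /=.
  by exists 1; [exact: c1|move=> w Jw; apply: idealM].
case: IH => [[v' v'us sub]|a nJau Ja].
  by apply: h; exists v' => //; rewrite inE v'us orbT.
have [b Jbv nJbu] : exists2 b, J (b * v) & ~ J (b * u).
  apply: contrapT => hb; apply: h; exists v; rewrite ?mem_head // => x Jxv.
  by apply: contrapT => nJxu; apply: hb; exists x.
exists (a * b); first by case/cM.
move=> w [c /Ja Jaw]; suff -> : a * b * w = b * (a * (w - c * v)) + a * c * (b * v).
  by apply: idealD => //; apply: idealM.
by ring.
Qed.

(* The maximal annihilators are the colons of finitely many elements: any u among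
   them lies in a finitely generated J + (u_1, ..., u_n), so the prime J : u
   contains, hence equals, one of the J : u_i. *)
Lemma zero_divisors_finite_union : exists us,
  (forall u, u \in us -> ~ J u) /\
  forall z v, ~ J v -> J (z * v) -> exists2 u, u \in us & colon J u z.
Proof.
pose span us := foldr (fun v K => adjoin K v) J us.
pose F K := exists2 us, (forall u, u \in us -> max_colon u) & K = span us.
have span_ideal us : is_ideal (span us) by elim: us => //= u us; apply: adjoin_ideal.
have sub_span us x : J x -> span us x.
  by move=> Jx; elim: us => //= u us; apply: sub_adjoin.
have [|| K [[us usmax ->] _ max]] := mpA (F := F) _ (J0 := J).
- by move=> _ [us _ ->]; split=> // x /AJ; apply: sub_span.
- by exists [::].
exists us; split=> [u /usmax []//|z v nJv Jzv].
have [u umax sub] := sub_max_colon nJv.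
have [|u' u'us sub'] := @sub_colon_of_mem_span u us (max_colon_prime umax).
  apply: (max (span (u :: us))); last exact: mem_adjoin.
  - by exists (u :: us) => // x; rewrite inE => /predU1P[->//|/usmax].
  - by move=> x; apply: sub_adjoin.
by exists u' => //; case: (usmax u' u'us) => _ h; apply: h sub' _ (sub _ Jzv); case: umax.
Qed.
End AssociatedPrimes.

Lemma finite_or_uniq (Q : nat -> Prop) n :
  (exists ts, [/\ uniq ts, size ts = n & forall t, t \in ts -> Q t]) \/
  exists bad : seq nat, forall t, Q t -> t \in bad.
Proof.
elim: n => [|n [[ts [uts sz Qts]]|]]; [by left; exists [::]| |by right].
case: (EM (exists bad : seq nat, forall t, Q t -> t \in bad)) => [|nbad]; first by right.
left; have [t Qt nt] : exists2 t, Q t & t \notin ts.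
  apply: contrapT => h; apply: nbad; exists ts => t Qt.
  by apply: contrapT => /negP nt; apply: h; exists t.
exists (t :: ts); split; rewrite /= ?nt ?sz // => t'; rewrite inE.
by move=> /predU1P[->|/Qts].
Qed.

Lemma fresh_nat (s : seq nat) : exists t, t \notin s.
Proof.
exists (\max_(i <- s) i).+1; apply/negP => ts.
by have := @leq_bigmax_seq _ s xpredT id _ ts isT; rewrite ltnn.
Qed.

(** * Depth and regular sequences in general position *)

Section Depth.
Variables (R : comNzRingType) (A m : R -> Prop) (w : nat -> R) (N : nat).
Hypotheses (mpA : max_principle A) (mw : forall t, m (w t)).
(** General position of the family [w]: N of its members suffice to generate all of m. *)
Hypothesis w_span : forall Q, is_ideal Q -> forall ts, uniq ts -> size ts = N ->
  (forall t, t \in ts -> Q (w t)) -> forall z, m z -> Q z.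

(** Weakly regular sequences: the ideal reached at the end may be the whole ring. *)
Fixpoint has_regular k (J : R -> Prop) : Prop :=
  if k is k.+1 then exists z, [/\ m z, nzd J z & has_regular k (adjoin J z)] else True.

Definition socle_free (J : R -> Prop) : Prop :=
  forall u, (forall z, m z -> J (z * u)) -> J u.

Lemma has_regular_socle_free k J : has_regular k.+1 J -> socle_free J.
Proof. by move=> [z [mz Jz _]] u /(_ z mz) /Jz. Qed.

(** The zero divisors modulo J lie in finitely many colons J : u with u outside J. None of these
    contains m, so each contains fewer than N of the [w t]. *)
Lemma generic_nzd J : is_ideal J -> (forall x, A x -> J x) -> socle_free J ->
  exists bad : seq nat, forall t, t \notin bad -> nzd J (w t).
Proof.
move=> iJ AJ sfJ; have [us [usJ usz]] := zero_divisors_finite_union mpA iJ AJ.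
suff [bad hbad] : exists bad : seq nat, forall u, u \in us -> forall t,
    colon J u (w t) -> t \in bad.
  exists bad => t /negP nt a Jta; apply: contrapT => nJa; apply: nt.
  by have [u uus] := usz _ _ nJa Jta; apply: hbad.
elim: us usJ {usz} => [|u us IH] usJ; first by exists [::].
case: IH => [v vus|bad hbad]; first by apply: usJ; rewrite inE vus orbT.
have [[ts [uts sz Jts]]|[bad' hbad']] := finite_or_uniq (fun t => colon J u (w t)) N.
  case: (usJ u (mem_head _ _)); apply: sfJ => z mz.
  exact: (w_span (colon_ideal u iJ) uts sz Jts).
exists (bad' ++ bad) => v; rewrite inE => /predU1P[->|vus] t ht; rewrite mem_cat.
  by rewrite hbad'.
by rewrite (hbad v) ?orbT.
Qed.

(** The equation z u = v y modulo J matches socle elements u modulo J + (y) with socle elements v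
    modulo J + (z). Both socles compute Ext^1(R/m, R/J). *)
Lemma socle_free_exchange J y z : is_ideal J -> m y -> m z -> nzd J y -> nzd J z ->
  socle_free (adjoin J z) -> socle_free (adjoin J y).
Proof.
move=> iJ my mz Jy Jz sf u hu; have [v Jv] := hu z mz.
have [c Jc] : adjoin J z v.
  apply: sf => x mx; have [b Jb] := hu x mx.
  exists b; apply: Jy.
  suff -> : y * (x * v - b * z) = z * (x * u - b * y) - x * (z * u - v * y).
    by apply: idealB => //; apply: idealM.
  by ring.
exists c; apply: Jz.
suff -> : z * (u - c * y) = (z * u - v * y) + y * (v - c * z).
  by apply: idealD => //; apply: idealM.
by ring.
Qed.

(* Induction on k through a third element w t, regular modulo both J + (y) and
   J + (z), for which both y, w t and z, w t can be swapped. *)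
Lemma has_regular_exchange k J y : is_ideal J -> (forall x, A x -> J x) ->
  m y -> nzd J y -> has_regular k.+1 J -> has_regular k (adjoin J y).
Proof.
elim: k J y => [//|k IH] J y iJ AJ my Jy [z [mz Jz regz]].
have iJy := adjoin_ideal y iJ; have iJz := adjoin_ideal z iJ.
have AJy x : A x -> adjoin J y x by move/AJ; apply: sub_adjoin.
have AJz x : A x -> adjoin J z x by move/AJ; apply: sub_adjoin.
have sfz := has_regular_socle_free regz.
have sfy := socle_free_exchange iJ my mz Jy Jz sfz.
have [bad1 hy] := generic_nzd iJy AJy sfy.
have [bad2 hz] := generic_nzd iJz AJz sfz.
have [t] := fresh_nat (bad1 ++ bad2); rewrite mem_cat negb_or => /andP[/hy wy /hz wz].
exists (w t); split=> //; rewrite adjoinC; apply: (IH) => //; first exact: adjoin_ideal.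
- by move=> x /AJ; apply: sub_adjoin.
- exact: nzd_swap.
exists z; split=> //; first exact: nzd_swap.
by rewrite adjoinC; apply: IH.
Qed.

Fixpoint regular_list (J : R -> Prop) (ls : seq R) : Prop :=
  if ls is l :: ls then nzd J l /\ regular_list (adjoin J l) ls else True.

Lemma generic_regular_list k J (bad : seq nat) :
  is_ideal J -> (forall x, A x -> J x) -> has_regular k J ->
  exists ts, [/\ size ts = k, uniq ts, {in ts, forall t, t \notin bad}
                & regular_list J (map w ts)].
Proof.
elim: k J bad => [|k IH] J bad iJ AJ reg; first by exists [::].
have [bad' hbad'] := generic_nzd iJ AJ (has_regular_socle_free reg).
have [t] := fresh_nat (bad ++ bad'); rewrite mem_cat negb_or => /andP[tb /hbad' wt].
(* Adding t to the forbidden indices keeps the chosen indices distinct. *)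
have [|x /AJ||ts [sz uts tsb reg']] := IH (adjoin J (w t)) (t :: bad).
- exact: adjoin_ideal.
- exact: sub_adjoin.
- exact: has_regular_exchange.
exists (t :: ts); split=> //=; first by rewrite sz.
- by rewrite uts andbT; apply/negP => /tsb; rewrite mem_head.
- by move=> t'; rewrite inE => /predU1P[->//|/tsb]; rewrite inE negb_or => /andP[].
Qed.
End Depth.

(** * Intersection with an ideal generated by a regular sequence *)

Section Product.
Variable R : comNzRingType.
Implicit Types (J : R -> Prop) (ls : seq R).

(** The product of the ideal generated by [ls] with J; for J the whole ring it is the ideal
    generated by [ls]. *)
Fixpoint combination ls J x : Prop :=
  if ls is l :: ls then exists2 j, J j & combination ls J (x - l * j) else x = 0.

Lemma combinationD ls J x y : is_ideal J ->
  combination ls J x -> combination ls J y -> combination ls J (x + y).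
Proof.
move=> iJ; elim: ls x y => [|l ls IH] x y /= => [-> ->|]; first exact: addr0.
move=> [i Ji hx] [j Jj hy]; exists (i + j); first exact: idealD.
by rewrite mulrDr opprD addrACA; apply: IH.
Qed.

Lemma combinationM ls J a x : is_ideal J ->
  combination ls J x -> combination ls J (a * x).
Proof.
move=> iJ; elim: ls x => [|l ls IH] x /= => [->|]; first exact: mulr0.
move=> [i Ji hx]; exists (a * i); first exact: idealM.
by rewrite mulrCA -mulrBr; apply: IH.
Qed.

Lemma combination_adjoin ls J l x : is_ideal J -> combination ls (adjoin J l) x ->
  exists2 y, combination ls (fun=> True) y & combination ls J (x - l * y).
Proof.
move=> iJ; elim: ls x => [|k ls IH] x /=.
  by move=> ->; exists 0 => //; rewrite mulr0 subr0.
move=> [i [a Ji] /IH [y hy hxy]]; exists (y + k * a).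
  by exists a => //; rewrite addrK.
exists (i - a * l) => //.
by suff -> : x - l * (y + k * a) - k * (i - a * l) = x - k * i - l * y by []; ring.
Qed.

Lemma combination_sub ls J x : is_ideal J ->
  combination ls J x -> J x.
Proof.
move=> iJ; elim: ls x => [|l ls IH] x /= => [->|[j Jj /IH]]; first exact: ideal0.
by move/ideal_subr; apply=> //; apply: idealM.
Qed.

(** Write x = l g + q with q generated by the tail. Then q is in J + (l), so by induction q = l y
    modulo the product of the tail with J. Hence l (g + y) is in J, and so is g + y. *)
Lemma regular_list_cap ls J x : is_ideal J -> regular_list J ls ->
  J x -> combination ls (fun=> True) x -> combination ls J x.
Proof.
elim: ls J x => [|l ls IH] J x iJ //= [Jl reg] Jx [g _ hq].
have [|y hy hxy] := combination_adjoin iJ (IH _ _ (adjoin_ideal l iJ) reg _ hq).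
  by exists (- g); rewrite mulNr opprK mulrC subrK.
exists (g + y); last by rewrite mulrDr opprD addrA.
apply: Jl; suff -> : l * (g + y) = x - (x - l * g - l * y).
  by apply: idealB => //; apply: combination_sub hxy.
by ring.
Qed.
End Product.

Lemma combination_ideal (R : comNzRingType) (ls : seq R) :
  is_ideal (combination ls (fun=> True)).
Proof.
split=> [|x y|a x]; [|exact: combinationD|exact: combinationM].
by elim: ls => //= l ls IH; exists 0; rewrite // mulr0 subr0.
Qed.

Lemma mem_combination (R : comNzRingType) (ls : seq R) l :
  l \in ls -> combination ls (fun=> True) l.
Proof.
elim: ls => //= k ls IH; rewrite inE => /predU1P[->|/IH h].
  exists 1 => //; rewrite mulr1 subrr; apply: ideal0; exact: combination_ideal.
by exists 0 => //; rewrite mulr0 subr0.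
Qed.

(** * Heights *)

Section Heights.
Variable R : comNzRingType.
Implicit Types (A B : idealr R) (P Q : prime_idealr R) (p x y g : R).

Lemma prime1 P : 1 \notin P. Proof. by rewrite idealr1. Qed.

Lemma primeM_notin P x y : x \notin P -> y \notin P -> x * y \notin P.
Proof. by move=> nx ny; rewrite prime_idealrM negb_or nx. Qed.

(** Otherwise an ideal over A maximal among those missing all s p^n, with s outside P, is prime. It
    lies in P (n = 0), so equals P by minimality, yet it misses p (s = 1, n = 1). *)
Lemma minimal_prime_nilpotent A P p : max_principle (fun x => x \in A) ->
  minimal_prime A P -> p \in P -> exists n, exists2 s, s \notin P & s * p ^+ n \in A.
Proof.
move=> mpA [AP Pmin] pP; apply: contrapT => h.
pose F K := [/\ is_ideal K, forall x, x \in A -> K x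
  & forall s n, s \notin P -> ~ K (s * p ^+ n)].
have [_ []//||K [[iK AK Kd] _ max]] := mpA F _ (fun x => x \in A).
  split=> //; first exact: idealr_is_ideal.
  by move=> s n nsP sA; apply: h; exists n, s.
have meet x : ~ K x -> exists s n, s \notin P /\ adjoin K x (s * p ^+ n).
  move=> nKx; apply: contrapT => hx; apply: nKx.
  apply: (max (adjoin K x)); [|by move=> y; apply: sub_adjoin|exact: mem_adjoin].
  split; [exact: adjoin_ideal|by move=> y /AK; apply: sub_adjoin|].
  by move=> s n nsP hs; apply: hx; exists s, n.
have K1 : ~ K 1 by move=> K1; apply: (Kd 1 0%N); rewrite ?prime1 ?mul1r.
have KM x y : K (x * y) -> K x \/ K y.
  move=> Kxy; case: (EM (K x)) => [|/meet[s [n [ns [a ha]]]]]; [by left|right].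
  apply: contrapT => /meet[t [k [nt [b hb]]]].
  apply: (Kd (s * t) (n + k)%N); first exact: primeM_notin.
  suff -> : s * t * p ^+ (n + k) =
      t * p ^+ k * (s * p ^+ n - a * x) + a * x * (t * p ^+ k - b * y) + a * b * (x * y).
    by apply: idealD => //; [apply: idealD => //|]; apply: idealM.
  by rewrite exprD; ring.
have [Q QK] := prime_idealr_of_ideal iK K1 KM.
have QP : Q =i P.
  apply: Pmin => x; first by move/AK/QK.
  by move=> /QK Kx; apply/negPn/negP => /(Kd x 0%N); rewrite mulr1.
apply: (Kd 1 1%N); first exact: prime1.
by rewrite mul1r; apply/QK; rewrite QP.
Qed.

(** Take A : g maximal among the colons with g nonzero in (R/A)_P. It lies in P. Any x in P is
    nilpotent in (R/A)_P, so it annihilates some multiple t x^k g that is still nonzero there; by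
    maximality x is already in A : g. *)
Lemma minimal_prime_associated A P : max_principle (fun x => x \in A) ->
  minimal_prime A P -> associated_prime A P.
Proof.
move=> mpA minP; have [AP _] := minP; have iA := idealr_is_ideal A.
pose F K := exists2 g, (forall s, s \notin P -> s * g \notin A) &
  K = colon (fun x => x \in A) g.
have [_ [g _ ->]||K [[g gd ->] _ max]] := mpA F _ (colon (fun x => x \in A) 1).
- by split=> [|x xA]; [exact: colon_ideal|rewrite /colon mulrC idealMr].
- by exists 1 => // s nsP; rewrite mulr1; apply: contra nsP => /AP.
exists g => x; apply/idP/idP => [xP|xgA]; last first.
  by apply/negPn/negP => /gd; rewrite xgA.
have [n [s nsP sxA]] := minimal_prime_nilpotent mpA minP xP.
(* k is the last exponent for which x^k g is nonzero in (R/A)_P. *)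
have [k [kd [t ntP txA]]] : exists k, (forall s, s \notin P -> s * (x ^+ k * g) \notin A) /\
    exists2 t, t \notin P & t * (x ^+ k.+1 * g) \in A.
  apply: contrapT => h.
  suff /(_ n s nsP) : forall k s, s \notin P -> s * (x ^+ k * g) \notin A.
    by rewrite mulrA mulrC idealMr.
  elim=> [|k IH] t ntP; first by rewrite mul1r; apply: gd.
  by apply/negP => tA; apply: h; exists k; split => //; exists t.
apply: (max (colon (fun x => x \in A) (t * (x ^+ k * g)))).
- by exists (t * (x ^+ k * g)) => // u nuP; rewrite mulrA; apply: kd; apply: primeM_notin.
- move=> y; rewrite /colon => ygA.
  suff -> : y * (t * (x ^+ k * g)) = t * x ^+ k * (y * g) by rewrite idealMr.
  by ring.
- rewrite /colon; suff -> : x * (t * (x ^+ k * g)) = t * (x ^+ k.+1 * g) by [].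
  by rewrite exprS; ring.
Qed.

Lemma prime_chain0 P : prime_chain 0 P.
Proof. by exists (fun=> P). Qed.

Lemma prime_chainS n P Q : {subset Q <= P} -> ~ {subset P <= Q} ->
  prime_chain n Q -> prime_chain n.+1 P.
Proof.
move=> QP nPQ [c [cn cS]]; exists (fun i => if (i <= n)%N then c i else P).
rewrite ltnn; split=> // i; rewrite ltnS; case: ltngtP => //= [lt_in|->] _.
  exact: cS.
by split=> [x|h]; [rewrite cn => /QP|apply: nPQ => x /h; rewrite cn].
Qed.

Lemma prime_height_exists P n : (forall k, prime_chain k P -> (k <= n)%N) ->
  exists2 k, prime_height P k & (k <= n)%N.
Proof.
elim: n => [|n IH] h; first by exists 0%N => //; split; first exact: prime_chain0.
case: (EM (prime_chain n.+1 P)) => [ch|nch]; first by exists n.+1.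
case: IH => [k ch|k hk kn]; last by exists k => //; exact: leqW.
by have := h k ch; rewrite leq_eqVlt => /predU1P[ek|//]; case: nch; rewrite -ek.
Qed.

Lemma height_minimal_prime A P h : height A h -> {subset A <= P} -> prime_height P h ->
  minimal_prime A P.
Proof.
move=> [_ hmin] AP [_ hP]; split=> // Q AQ QP.
suff PQ : {subset P <= Q} by move=> x; apply/idP/idP => [/QP|/PQ].
apply: contrapT => nPQ.
(* A chain ending at Q extends by P, so its length is below h; for h = 0 there would be no such
   chain. *)
have [k hk kle] : exists2 k, prime_height Q k & (k <= h.-1)%N.
  apply: prime_height_exists => k ch; have := hP _ (prime_chainS QP nPQ ch).
  by case: (h).
have := hmin _ _ AQ hk; have := hP _ (prime_chainS QP nPQ hk.1).
by move=> lt_kh; rewrite leqNgt lt_kh.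
Qed.

(** Otherwise P is minimal over A, hence associated, hence of height h by unmixedness; but P
    contains B, of height h + 1. *)
Lemma prime_between A B P h : max_principle (fun x => x \in A) -> unmixed A ->
  height A h -> height B h.+1 -> {subset A <= B} -> {subset B <= P} ->
  exists Q, [/\ {subset A <= Q}, {subset Q <= P} & ~ {subset P <= Q}].
Proof.
move=> mpA umA hA hB AB BP; apply: contrapT => h'.
have minP : minimal_prime A P.
  split=> [x /AB/BP//|Q AQ QP x]; apply/idP/idP => [/QP//|].
  suff PQ : {subset P <= Q} by move/PQ.
  by apply: contrapT => nPQ; apply: h'; exists Q.
have [P0 AP0 hP0] := hA.1.
have minP0 := height_minimal_prime hA AP0 hP0.
have := umA _ _ _ (minimal_prime_associated mpA minP0) (minimal_prime_associated mpA minP) hP0.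
by move=> /(hB.2 _ _ BP); rewrite ltnn.
Qed.
End Heights.

Section RegularSequences.
Variable R : comNzRingType.

Lemma ideal_genP (s : seq R) x :
  ideal_gen s x <-> exists c : nat -> R, x = \sum_(i < size s) c i * s`_i.
Proof.
split=> [[c ->]|[c ->]]; last by exists (fun i => c i).
exists (fun i => if insub i is Some j then c j else 0).
by apply: eq_bigr => i _; rewrite valK.
Qed.

Lemma ideal_gen_rcons (s : seq R) a x :
  ideal_gen (rcons s a) x <-> exists c, ideal_gen s (x - c * a).
Proof.
have nth_lt (i : 'I_(size s)) : (rcons s a)`_i = s`_i by rewrite nth_rcons ltn_ord.
split=> [/ideal_genP[c]|[b /ideal_genP[c hc]]].
  rewrite size_rcons big_ord_recr /= nth_rcons ltnn eqxx => ->.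
  exists (c (size s)); apply/ideal_genP; exists c; rewrite addrK.
  by apply: eq_bigr => i _; rewrite nth_lt.
apply/ideal_genP; exists (fun i => if (i < size s)%N then c i else b).
rewrite size_rcons big_ord_recr /= nth_rcons ltnn eqxx -[LHS](subrK (b * a)) hc.
by congr (_ + _); apply: eq_bigr => i _; rewrite nth_lt ltn_ord.
Qed.

End RegularSequences.

Lemma ideal_gen_ideal (R : comNzRingType) (s : seq R) : is_ideal (ideal_gen s).
Proof.
split=> [|x y [c ->] [e ->]|a x [c ->]].
- by exists (fun=> 0); rewrite big1 // => i _; rewrite mul0r.
- exists (fun i => c i + e i); rewrite -big_split.
  by apply: eq_bigr => i _; rewrite mulrDl.
- exists (fun i => a * c i); rewrite mulr_sumr.
  by apply: eq_bigr => i _; rewrite mulrA.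
Qed.

Lemma mem_ideal_gen (R : comNzRingType) (s : seq R) x a : x \in s -> ideal_gen s (a * x).
Proof.
move=> /(nthP 0)[i lt_i <-]; exists (fun j => if val j == i then a else 0).
rewrite (bigD1 (Ordinal lt_i)) //= eqxx big1 ?addr0 // => j.
by rewrite -val_eqE /= => /negPf ->; rewrite mul0r.
Qed.

Section Quotient.
Variable R : comNzRingType.

Lemma has_regular_ext (m J K : R -> Prop) k : (forall x, J x <-> K x) ->
  has_regular m k J -> has_regular m k K.
Proof. by move=> JK; rewrite (_ : K = J) //; apply/funext => x; apply/propext; rewrite JK. Qed.

Lemma has_regular_leq (m J : R -> Prop) k l : (k <= l)%N ->
  has_regular m l J -> has_regular m k J.
Proof.
elim: l k J => [|l IH] [|k] J //= lekl [z [mz Jz reg]].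
by exists z; split=> //; apply: IH.
Qed.

Variables (T : comNzRingType) (A : idealr R) (pi : {rmorphism R -> T}).
Hypotheses (pi_surj : forall q, exists x, pi x = q) (pi_ker : forall x, pi x = 0 <-> x \in A).

Lemma regular_seq_has_regular (M : idealr T) (m : R -> Prop) (s : seq T) :
  (forall x, pi x \in M -> m x) -> {subset s <= M} -> regular_seq s ->
  has_regular m (size s) (fun x => x \in A).
Proof.
move=> Mm sM [_ reg].
(* Induction on the number k of elements still to be used, modulo the preceding [size s - k]. *)
suff /(_ (size s)) : forall k, (k <= size s)%N ->
    has_regular m k (fun x => ideal_gen (take (size s - k) s) (pi x)).
  move=> /(_ (leqnn _)); apply: has_regular_ext => x; rewrite subnn take0 -pi_ker.
  split=> [[c ->]|->]; first by rewrite big_ord0.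
  by exists (fun=> 0); rewrite big_ord0.
elim=> [//|k IH] lek /=; set i := (size s - k.+1)%N.
have lt_i : (i < size s)%N by rewrite ltn_subrL /= (leq_trans _ lek).
have [z zE] := pi_surj s`_i.
exists z; split.
- by apply: Mm; rewrite zE; apply/sM/mem_nth.
- by move=> a; rewrite rmorphM zE; apply: reg.
apply: has_regular_ext (IH (ltnW lek)) => x.
rewrite (_ : size s - k = i.+1)%N; last by rewrite subnSK.
rewrite (take_nth 0) // ideal_gen_rcons; split=> [[c]|[c]].
  by have [b <-] := pi_surj c; exists b; rewrite rmorphB rmorphM zE.
by rewrite rmorphB rmorphM zE; exists (pi c).
Qed.

Lemma image_prime (P : prime_idealr R) : {subset A <= P} ->
  exists P' : prime_idealr T, forall x, (pi x \in P') = (x \in P).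
Proof.
move=> AP; have [iP P1 PM] := prime_idealr_is_prime P.
have piP x := image_pi pi_ker x iP AP.
have [||Q hQ] := prime_idealr_of_ideal (image_ideal pi_surj iP).
- by rewrite -(rmorph1 pi) piP.
- move=> q r; have [x <-] := pi_surj q; have [y <-] := pi_surj r.
  by rewrite -rmorphM !piP; apply: PM.
by exists Q => x; apply/idP/idP => [/hQ/piP|/piP/hQ].
Qed.

(** The chain descends to T and bounds the height of its last member from below. That member is
    maximal, since the last hypothesis makes R / c k a field; there depth equals height, and a
    regular sequence lifts to R. *)
Lemma cohen_macaulay_has_regular (c : nat -> prime_idealr R) k :
  cohen_macaulay T -> {subset A <= c 0%N} ->
  (forall i, (i < k)%N -> {subset c i <= c i.+1} /\ ~ {subset c i.+1 <= c i}) ->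
  (forall x, x \notin c k -> exists a, 1 - a * x \in c k) ->
  has_regular (fun x => x \in c k) k (fun x => x \in A).
Proof.
move=> [_ cmT] A0 cS cmax.
have Ac i : (i <= k)%N -> {subset A <= c i}.
  by elim: i => [//|i IH] lt_ik x /(IH (ltnW lt_ik)); case: (cS i lt_ik) => h _ /h.
(* Beyond index k any prime of T serves as filler. *)
have /choice [c' hc'] i : exists Q : prime_idealr T, (i <= k)%N ->
    forall x, (pi x \in Q) = (x \in c i).
  case: (leqP i k) => [/Ac/image_prime[Q hQ]|]; first by exists Q.
  by have [Q _] := image_prime A0; exists Q.
have maxM : maximal_ideal (c' k : idealr T).
  move=> J MJ q; apply/idP/idP => [qJ|/MJ//].
  have [x eq] := pi_surj q; rewrite -eq hc' //; apply/negPn/negP => /cmax[a].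
  rewrite -hc' // => /MJ; rewrite rmorphB rmorph1 rmorphM eq => h.
  by have := rpredD h (idealMr (pi a) qJ); rewrite subrK idealr1.
have [n [[P MP [_ hP]] _] [[s [sz sM reg]] _]] := cmT _ maxM.
have lekn : (k <= n)%N.
  apply: hP; exists c'; split=> [q|i lt_ik].
    by apply/esym; apply: maxM.
  have [le1 le2] := cS i lt_ik; split=> [q|h].
    by have [x <-] := pi_surj q; rewrite !hc' ?(ltnW lt_ik) //; apply: le1.
  by apply: le2 => x; rewrite -!hc' ?(ltnW lt_ik) //; apply: h.
refine (has_regular_leq lekn _); rewrite -sz.
by apply: regular_seq_has_regular sM reg => x; rewrite hc'.
Qed.
End Quotient.

(** * Monomial ideals and linear forms *)

Section Monomials.
Variables (K : fieldType) (n : nat).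
Local Notation S := {mpoly K[n]}.
Implicit Types (p q : S) (m u : 'X_{1..n}) (ms : seq 'X_{1..n}) (V : pred 'I_n).

Lemma msupp_ideal_gen ms p m : ideal_gen [seq 'X_[u] : S | u <- ms] p ->
  m \in msupp p -> exists2 u, u \in ms & (u <= m)%MM.
Proof.
move=> [c ->]; move/msupp_sum_le/flattenP => [_ /mapP[i _ ->]].
move: i c; rewrite size_map => i c.
rewrite (nth_map 0%MM) // (perm_mem (msuppMX _ _)) => /mapP[m' _ ->].
by exists (nth 0%MM ms i); [exact: mem_nth|exact: lem_addr].
Qed.

Lemma mpolyX_ideal_gen ms u m : u \in ms -> (u <= m)%MM ->
  ideal_gen [seq 'X_[u] : S | u <- ms] 'X_[m].
Proof.
by move=> ums le_um; rewrite -(submK le_um) mpolyXD; apply: mem_ideal_gen; apply: map_f.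
Qed.

Definition zero_vars V : n.-tuple S := [tuple if V i then 0 else 'X_i | i < n].

Lemma mcoeff_zero_vars V p u :
  (p \mPo zero_vars V)@_u = if [exists i, V i && (0 < u i)%N] then 0 else p@_u.
Proof.
have compX m : 'X_[m] \mPo zero_vars V =
    if [exists i, V i && (0 < m i)%N] then 0 else 'X_[m].
  rewrite comp_mpolyX; case: existsP => [[i /andP[Vi mi]]|h].
    by rewrite (bigD1 i) //= tnth_mktuple Vi expr0n gtn_eqF // mul0r.
  rewrite mpolyXE_id; apply: eq_bigr => i _; rewrite tnth_mktuple.
  case: ifP => // Vi; case: (posnP (m i)) => [->|mi]; first by rewrite !expr0.
  by case: h; exists i; rewrite Vi.
rewrite comp_mpolyEX [p in RHS]mpolyE !raddf_sum /=.
case: ifP => h; last first.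
  apply: eq_bigr => m _; rewrite !mcoeffZ compX.
  case: ifP => // hm; rewrite mcoeff0 mcoeffX.
  by case: eqP => [emu|_]; [rewrite emu h in hm|rewrite mulr0].
apply: big1 => m _; rewrite mcoeffZ compX.
case: ifP => hm; first by rewrite mcoeff0 mulr0.
by rewrite mcoeffX; case: eqP => [emu|_]; [rewrite emu h in hm|rewrite mulr0].
Qed.

(** The ideal of the variables in V is the kernel of the substitution [zero_vars] into a domain,
    hence prime. The coefficient condition says that every monomial of p involves such a
    variable. *)
Lemma var_prime_exists V : exists P : prime_idealr S, forall p,
  p \in P <-> forall u, (forall i, V i -> u i = 0%N) -> p@_u = 0.
Proof.
pose J p := p \mPo zero_vars V = 0.
have JP p : J p <-> forall u, (forall i, V i -> u i = 0%N) -> p@_u = 0.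
  split=> [Jp u hu|h].
    have := mcoeff_zero_vars V p u; rewrite Jp mcoeff0.
    by case: existsP => // -[i /andP[/hu ->]].
  apply/mpolyP => u; rewrite mcoeff_zero_vars mcoeff0; case: existsP => // hu.
  apply: h => i Vi; apply/eqP; rewrite -leqn0 leqNgt; apply/negP => ui.
  by apply: hu; exists i; rewrite Vi.
have iJ : is_ideal J.
  split=> [|p q hp hq|a p hp]; rewrite /J ?rmorph0 //.
    by rewrite rmorphD /= hp hq addr0.
  by rewrite rmorphM /= hp mulr0.
have [||P hP] := prime_idealr_of_ideal iJ.
- by rewrite /J rmorph1; apply/eqP; apply: oner_neq0.
- by move=> p q; rewrite /J rmorphM => /eqP; rewrite mulf_eq0 => /orP[]/eqP; [left|right].
by exists P => p; rewrite hP.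
Qed.

Lemma mpolyX_ideal (J : S -> Prop) m u : is_ideal J -> (u <= m)%MM -> J 'X_[u] -> J 'X_[m].
Proof. by move=> iJ le_um Ju; rewrite -(submK le_um) mpolyXD; apply: idealM. Qed.

Lemma mpolyX_lem m i : (0 < m i)%N -> (U_(i) <= m)%MM.
Proof. by move=> mi; apply/mnm_lepP => j; rewrite mnm1E; case: eqP => // <-. Qed.

Lemma irrelevant_ideal_min (J : S -> Prop) p : is_ideal J -> (forall i, J 'X_i) ->
  p@_0%MM = 0 -> J p.
Proof.
move=> iJ JX p0; rewrite (mpolyE p) big_seq; apply: ideal_sum => // m mp.
rewrite -mul_mpolyC; apply: idealM => //.
have [i mi] : exists i, (0 < m i)%N.
  apply: contrapT => h; move: mp; rewrite mcoeff_msupp -p0 => /eqP; apply.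
  congr (_@_ _); apply/mnmP => i; rewrite mnm0E; apply/eqP; rewrite -leqn0 leqNgt.
  by apply/negP => mi; apply: h; exists i.
exact: mpolyX_ideal (mpolyX_lem mi) (JX i).
Qed.

Lemma mcoeffM_low p q k l m :
  (forall u, (mdeg u < k)%N -> p@_u = 0) -> (forall u, (mdeg u < l)%N -> q@_u = 0) ->
  (mdeg m < k + l)%N -> (p * q)@_m = 0.
Proof.
move=> hp hq lt_m; apply: memN_msupp_eq0; apply/negP.
move=> /msuppM_le/allpairsP[[a b] /= [ap bq em]].
move: lt_m; rewrite em mdegD ltnNge leq_add // leqNgt; apply/negP.
  by move/hp/eqP; rewrite mcoeff_eq0 ap.
by move/hq/eqP; rewrite mcoeff_eq0 bq.
Qed.

Lemma mcoeff_combination_low (ls : seq S) (J : S -> Prop) k p :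
  (forall l, l \in ls -> l@_0%MM = 0) ->
  (forall a, J a -> forall u, (mdeg u < k)%N -> a@_u = 0) ->
  combination ls J p -> forall u, (mdeg u < k.+1)%N -> p@_u = 0.
Proof.
move=> hls hJ; elim: ls p hls => [|l ls IH] p hls /=; first by move=> -> u; rewrite mcoeff0.
move=> [a Ja hp] u lt_u; rewrite -(subrK (l * a) p) mcoeffD.
rewrite (IH _ _ hp) // => [|l' l'ls]; last by apply: hls; rewrite inE l'ls orbT.
rewrite add0r; apply: (@mcoeffM_low _ _ 1 k) => [v||]; [|exact: hJ|by []].
by rewrite ltnS leqn0 mdeg_eq0 => /eqP ->; apply: hls; rewrite mem_head.
Qed.
End Monomials.

Lemma exists_left_kernel (F : fieldType) k l (M : 'M[F]_(k, l)) : (l < k)%N ->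
  exists2 v : 'rV[F]_k, v != 0 & v *m M = 0.
Proof.
move=> lt_lk; exists (nz_row (kermx M)).
  rewrite nz_row_eq0 -mxrank_eq0 mxrank_ker subn_eq0 -ltnNge.
  exact: leq_ltn_trans (rank_leq_col M) lt_lk.
by apply/sub_kermxP; apply: nz_row_sub.
Qed.

Section LinearForms.
Variable n : nat.
Local Notation S := {mpoly rat[n]}.

(* Any n of these forms span all linear forms, by Vandermonde, so every ideal not
   containing the irrelevant ideal contains fewer than n of them. *)
Definition moment_form (t : nat) : S := \sum_(j < n) t%:R ^+ j *: 'X_j.

Lemma moment_form_mcoeff0 t : (moment_form t)@_0%MM = 0.
Proof.
rewrite raddf_sum big1 //= => j _; rewrite mcoeffZ mcoeffX.
by rewrite -mdeg_eq0 mdeg1 mulr0.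
Qed.

Lemma vandermonde_inverse k (ts : seq nat) : uniq ts -> size ts = k ->
  exists U : 'M[rat]_k, forall j l : 'I_k,
    \sum_(i < k) U j i * (nth 0%N ts i)%:R ^+ l = (j == l)%:R.
Proof.
move=> uts sz; pose a : 'rV[rat]_k := \row_i (nth 0%N ts i)%:R.
have Vu : (Vandermonde k a)^T \in unitmx.
  rewrite unitmx_tr unitmxE det_Vandermonde unitfE.
  apply/prodf_neq0 => i _; apply/prodf_neq0 => j lt_ij.
  rewrite !mxE subr_eq0 Num.Theory.eqr_nat nth_uniq ?sz //.
  by rewrite gtn_eqF.
exists (invmx (Vandermonde k a)^T) => j l.
have /matrixP/(_ j l) := mulVmx Vu; rewrite !mxE => <-.
by apply: eq_bigr => i _; rewrite !mxE.
Qed.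

(** The inverse of the k by k Vandermonde block solves the k forms for the first k variables. *)
Lemma moment_forms_eliminate (J : S -> Prop) (ts : seq nat) k (lekn : (k <= n)%N) :
  is_ideal J -> uniq ts -> size ts = k -> (forall t, t \in ts -> J (moment_form t)) ->
  forall j : 'I_n, (j < k)%N -> exists c : 'I_n -> rat,
    J ('X_j - \sum_(l < n | (k <= l)%N) c l *: 'X_l).
Proof.
move=> iJ uts sz Jts j lt_jk; have [U hU] := vandermonde_inverse uts sz.
pose j' := Ordinal lt_jk.
exists (fun l => - \sum_(i < k) U j' i * (nth 0%N ts i)%:R ^+ l).
suff -> : 'X_j - \sum_(l < n | (k <= l)%N)
      (- \sum_(i < k) U j' i * (nth 0%N ts i)%:R ^+ l) *: 'X_l
    = \sum_(i < k) (U j' i)%:MP * moment_form (nth 0%N ts i).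
  apply: ideal_sum => // i _; apply: idealM => //; apply/Jts/mem_nth.
  by rewrite sz.
have -> : \sum_(i < k) (U j' i)%:MP * moment_form (nth 0%N ts i) =
    \sum_(l < n) (\sum_(i < k) U j' i * (nth 0%N ts i)%:R ^+ l) *: 'X_l.
  under eq_bigr do rewrite mul_mpolyC scaler_sumr.
  rewrite exchange_big /=; apply: eq_bigr => l _.
  by rewrite scaler_suml; apply: eq_bigr => i _; rewrite scalerA.
rewrite [RHS](bigID (fun l : 'I_n => (k <= l)%N)) /= [RHS]addrC -sumrN.
congr (_ + _); last first.
  by apply: eq_bigr => l _; rewrite scaleNr opprK.
rewrite (bigD1 j) ?ltnNge //= -?ltnNge // (hU j' j') eqxx scale1r big1 ?addr0 // => l.
rewrite -ltnNge => /andP[lt_lk /negPf ne_lj].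
by rewrite (hU j' (Ordinal lt_lk)) -val_eqE /= eq_sym val_eqE ne_lj scale0r.
Qed.

Lemma moment_forms_span (J : S -> Prop) : is_ideal J ->
  forall ts, uniq ts -> size ts = n -> (forall t, t \in ts -> J (moment_form t)) ->
  forall p, p@_0%MM = 0 -> J p.
Proof.
move=> iJ ts uts sz Jts p; apply: irrelevant_ideal_min => // j.
have [c] := moment_forms_eliminate (leqnn n) iJ uts sz Jts (ltn_ord j).
by rewrite big_pred0 ?subr0 // => l; rewrite leqNgt ltn_ord.
Qed.
End LinearForms.

Section VariablePrimes.
Variables (K : fieldType) (n : nat).
Local Notation S := {mpoly K[n]}.

Definition vanishing (V : pred 'I_n) (p : S) : Prop :=
  forall u : 'X_{1..n}, (forall i, V i -> u i = 0%N) -> p@_u = 0.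

Lemma vanishing_sub (V W : pred 'I_n) p : {subset V <= W} ->
  vanishing V p -> vanishing W p.
Proof. by move=> VW h u hu; apply: h => i /VW/hu. Qed.

(** Above Q and P the chain adjoins the variables outside V one at a time, up to the irrelevant
    ideal. *)
Lemma var_prime_chain (V : pred 'I_n) (P Q : prime_idealr S) :
  (forall p, p \in P <-> vanishing V p) -> {subset Q <= P} -> ~ {subset P <= Q} ->
  let k := #|[pred i | ~~ V i]|.+1 in exists c : nat -> prime_idealr S,
    [/\ c 0%N = Q,
        forall i, (i < k)%N -> {subset c i <= c i.+1} /\ ~ {subset c i.+1 <= c i}
      & forall p, p \in c k <-> p@_0%MM = 0].
Proof.
move=> PV QP nPQ k; pose a := enum [pred i | ~~ V i].
have sz_a : size a = k.-1 by rewrite -cardE.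
have /choice [W hW] : forall U, exists P : prime_idealr S, forall p, p \in P <-> vanishing U p.
  exact: var_prime_exists.
pose Vj j := [pred x | V x || (x \in take j a)].
(* Index 0 is Q, so index j + 1 is P with j further variables; in particular index 1 is P. *)
exists (fun i => if i is j.+1 then W (Vj j) else Q); split=> //.
  case=> [_|j lt_j].
    have WP p : p \in W (Vj 0%N) <-> p \in P.
      by rewrite hW PV; split; apply: vanishing_sub => x; rewrite !inE take0 ?orbF.
    by split=> [p /QP /WP//|h]; apply: nPQ => p /WP/h.
  have {}lt_j : (j < size a)%N by rewrite sz_a.
  have [x0 _] : exists x0 : 'I_n, True by case: (a) lt_j => // x0; exists x0.
  pose x := nth x0 a j.
  have takeS : take j.+1 a = rcons (take j a) x by apply: take_nth.
  split=> [p|h].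
    rewrite !hW; apply: vanishing_sub => i; rewrite !inE takeS mem_rcons inE.
    by case/orP=> ->; rewrite ?orbT.
  have /h/hW/(_ U_(x)%MM) : 'X_x \in W (Vj j.+1).
    apply/hW => u /(_ x); rewrite /= takeS mem_rcons mem_head orbT => /(_ isT) ux.
    by rewrite mcoeffX; case: eqP => // eu; move: ux; rewrite -eu mnm1E eqxx.
  rewrite mcoeffX eqxx => one0; have /eqP := oner_neq0 K; apply; apply: one0 => i.
  rewrite mnm1E; case: eqP => //= <-; rewrite (negPf (_ : ~~ V x)) /=; last first.
    by have := mem_nth x0 lt_j; rewrite mem_enum.
  have := enum_uniq [pred i | ~~ V i]; rewrite -/a -{1}(cat_take_drop j a) cat_uniq.
  by rewrite (drop_nth x0) //= => /and3P[_ /norP[/negPf nx _] _]; rewrite nx.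
move=> p; rewrite hW; split=> [|p0 u hu]; first by apply=> i _; rewrite mnm0E.
rewrite (_ : u = 0%MM) //; apply/mnmP => i; rewrite mnm0E; apply: hu.
by rewrite /= take_oversize ?sz_a // mem_enum /= orbN.
Qed.
End VariablePrimes.

(** * The triangulation and the link *)

Definition triples : seq (nat * nat * nat) :=
  [:: (1, 2, 3); (1, 2, 4); (1, 3, 5); (1, 4, 6); (1, 5, 6);
      (2, 3, 6); (2, 4, 5); (2, 5, 6); (3, 4, 5); (3, 4, 6)]%N.

(** The triples count variables from 1 and ['I_6] from 0, whence the predecessors. Plain numbers let
    the finite checks on triples run by computation. *)
Definition occ (t : nat * nat * nat) (i : nat) : nat :=
  (t.1.1.-1 == i) + (t.1.2.-1 == i) + (t.2.-1 == i).

Definition triple_mon (t : nat * nat * nat) : 'X_{1..6} :=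
  (U_(inord t.1.1.-1) + U_(inord t.1.2.-1) + U_(inord t.2.-1))%MM.

Lemma triple_monE t (i : 'I_6) : t \in triples -> triple_mon t i = occ t i.
Proof.
move=> tT; have : [&& t.1.1.-1 < 6, t.1.2.-1 < 6 & t.2.-1 < 6]%N.
  by apply: (allP (a := fun t => [&& t.1.1.-1 < 6, t.1.2.-1 < 6 & t.2.-1 < 6]%N) _ _ tT).
case/and3P=> h1 h2 h3; rewrite /triple_mon /occ !mnmDE !mnm1E.
by rewrite -!val_eqE /= !inordK.
Qed.

Lemma mdeg_triple_mon t : mdeg (triple_mon t) = 3.
Proof. by rewrite /triple_mon !mdegD !mdeg1. Qed.

Lemma I_DeltaE : I_Delta =
  ideal_gen [seq 'X_[m] : {mpoly rat[6]} | m <- map triple_mon triples].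
Proof. by rewrite /I_Delta /cubic /= /triple_mon !mpolyXD. Qed.

Lemma triples_meet t t' : t \in triples -> t' \in triples ->
  exists i : 'I_6, (0 < occ t i)%N && (0 < occ t' i)%N.
Proof.
have chk : all (fun t => all (fun t' => has (fun k => (0 < occ t k) && (0 < occ t' k))
    (iota 0 6)) triples)%N triples by [].
move=> /(allP chk)/allP h /h /hasP[k]; rewrite mem_iota /= add0n => lt_k hk.
by exists (Ordinal lt_k).
Qed.

(* Alexander self-duality of the triangulation: the complement of a face is not
   a face. *)
Lemma disjoint_triple (m : 'X_{1..6}) :
  (forall t, t \in triples -> ~~ (triple_mon t <= m)%MM) ->
  exists2 t, t \in triples & forall i : 'I_6, (0 < occ t i)%N -> m i = 0%N.
Proof.
(* Only the support of m matters, so the claim becomes one about six booleans. *)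
move=> hm; pose b := [seq (0 < m (inord k))%N | k <- iota 0 6].
have b_nth (i : 'I_6) : nth false b i = (0 < m i)%N.
  by rewrite (nth_map 0%N) ?size_iota // nth_iota // add0n inord_val.
have h1 : all (fun t => has (fun k => (0 < occ t k)%N && ~~ nth false b k) (iota 0 6)) triples.
  apply/allP => t tT; have := hm t tT; apply: contraR => /hasPn h.
  apply/mnm_lepP => i; rewrite triple_monE //.
  have := h i; rewrite mem_iota /= add0n ltn_ord b_nth negb_and negbK => /(_ isT).
  have occ1 : (occ t i <= 1)%N.
    have chk : all (fun t => all (fun k => occ t k <= 1) (iota 0 6))%N triples by [].
    by apply: (allP (allP chk t tT)); rewrite mem_iota add0n ltn_ord.
  by rewrite -eqn0Ngt => /orP[/eqP->//|]; apply: leq_trans.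
have h2 :
    has (fun t => all (fun k => (0 < occ t k)%N ==> ~~ nth false b k) (iota 0 6)) triples.
  move: h1; rewrite /b /=.
  (* All 64 supports are checked by computation. *)
  by do 6!move: (0 < m _)%N; do 6!case.
have /hasP[t tT /allP ht] := h2; exists t => // i oi.
have := ht i; rewrite mem_iota /= add0n ltn_ord oi b_nth /= => /(_ isT).
by rewrite -eqn0Ngt => /eqP.
Qed.

Lemma triple_compl t : t \in triples -> #|[pred i : 'I_6 | ~~ (0 < occ t i)%N]| = 3.
Proof.
move=> tT; rewrite cardE /enum_mem size_filter -enumT.
transitivity (count (fun k => ~~ (0 < occ t k)%N) (map val (enum 'I_6))).
  by rewrite count_map; apply: eq_count => i.
rewrite val_enum_ord; apply/eqP.
have chk : all (fun t => count (fun k => ~~ (0 < occ t k)) (iota 0 6) == 3)%N triples.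
  by [].
exact: (allP chk t tT).
Qed.

Lemma triple_mon_inj : {in triples &, injective triple_mon}.
Proof.
have chk : all (fun t => all (fun t' => (map (occ t) (iota 0 6) == map (occ t') (iota 0 6)) ==>
  (t == t')) triples) triples by [].
move=> t t' tT tT' e; apply/eqP; apply: (implyP (allP (allP chk t tT) t' tT')).
apply/eqP/eq_in_map => k; rewrite mem_iota /= add0n => lt_k.
by rewrite -[k]/(val (Ordinal lt_k)) -!triple_monE // e.
Qed.

(** Each vertex lies in five of the ten triples; this is the number of conditions that will force p
    into A. *)
Lemma triples_containing (i : 'I_6) : exists g : 'I_5 -> nat * nat * nat,
  forall t, t \in triples -> (0 < occ t i)%N -> exists q, t = g q.
Proof.
exists (fun q => nth (0, 0, 0)%N [seq t <- triples | (0 < occ t i)%N] q) => t tT ti.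
have tF : t \in [seq t <- triples | (0 < occ t i)%N] by rewrite mem_filter ti.
have sz : (size [seq t <- triples | (0 < occ t i)%N] <= 5)%N.
  by case: i {ti tF}; do 6!case=> //.
have lt_q : (index t [seq t <- triples | (0 < occ t i)%N] < 5)%N.
  by apply: leq_trans sz; rewrite index_mem.
by exists (Ordinal lt_q); rewrite /= nth_index.
Qed.

Local Notation S := {mpoly rat[6]}.

(** Modulo four moment forms every variable is a combination of the last two, so a cubic monomial
    becomes a binary cubic form, with four coefficients. *)
Lemma cubic_reduce (J : S -> Prop) (ts : seq nat) t : is_ideal J ->
  uniq ts -> size ts = 4 -> (forall t, t \in ts -> J (moment_form 6 t)) ->
  exists N : 'I_4 -> rat, J ('X_[triple_mon t] -
    \sum_(k < 4) (N k)%:MP * ('X_(inord 4) ^+ k * 'X_(inord 5) ^+ (3 - k))).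
Proof.
move=> iJ uts sz Jts; set x := 'X_(inord 4); set y := 'X_(inord 5).
have lin (j : 'I_6) : exists a b : rat, J ('X_j - (a%:MP * x + b%:MP * y)).
  case: (ltnP j 4) => [lt_j|le_j].
    have [c hc] := moment_forms_eliminate (leqnn 4 : (4 <= 6)%N) iJ uts sz Jts lt_j.
    exists (c (inord 4)), (c (inord 5)); move: hc.
    rewrite big_mkcond !big_ord_recl big_ord0 /= !add0r addr0 -!mul_mpolyC.
    congr (J (_ - (_%:MP * 'X_(_) + _%:MP * 'X_(_)))); f_equal; apply/val_inj;
    by rewrite /= inordK.
  case: (eqVneq (j : nat) 4%N) => [e4|n4].
    exists 1, 0; rewrite mpolyC1 mpolyC0 mul1r mul0r addr0.
    rewrite (_ : j = inord 4) ?subrr; first exact: ideal0.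
    by apply/val_inj; rewrite /= inordK.
  exists 0, 1; rewrite mpolyC1 mpolyC0 mul1r mul0r add0r.
  rewrite (_ : j = inord 5) ?subrr; first exact: ideal0.
  apply/val_inj; rewrite /= inordK //; apply/eqP; rewrite eqn_leq -ltnS ltn_ord.
  by rewrite ltn_neqAle eq_sym n4.
have [a1 [b1 h1]] := lin (inord t.1.1.-1).
have [a2 [b2 h2]] := lin (inord t.1.2.-1).
have [a3 [b3 h3]] := lin (inord t.2.-1).
(* Coefficients of the product of the three binary linear forms, by increasing power of x. *)
pose N := [:: b1 * b2 * b3; a1 * b2 * b3 + b1 * a2 * b3 + b1 * b2 * a3;
  a1 * a2 * b3 + a1 * b2 * a3 + b1 * a2 * a3; a1 * a2 * a3].
exists (fun k => N`_k); rewrite /triple_mon !mpolyXD.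
have := idealMB iJ (idealMB iJ h1 h2) h3.
suff -> : (a1%:MP * x + b1%:MP * y) * (a2%:MP * x + b2%:MP * y) * (a3%:MP * x + b3%:MP * y)
  = \sum_(k < 4) (N`_k)%:MP * (x ^+ k * y ^+ (3 - k)) by [].
rewrite !big_ord_recr big_ord0 /= !rmorphD !rmorphM /= !subSS !subn0.
ring.
Qed.

Theorem proposition4p2 :
  ~ exists (d : nat) (f : {mpoly rat[6]}) (A B : idealr {mpoly rat[6]}),
      squarefree_monomial_ideal B /\ basic_double_G_link d I_Delta f B A.
Proof.
move=> [d [f [A [B [[ms _ Bms] [[homA _ umA] [_ _ _] [AB CM _ [h hA hB]] [d0 fd fnz] CI]]]]]].
rewrite I_DeltaE in CI.
set I := ideal_gen _ in CI.
have iI : is_ideal I by apply: ideal_gen_ideal.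
have AI a : a \in A -> I a.
  by move=> aA; apply/CI; exists 0, a; rewrite idealr0 mulr0 add0r.
have fBI b : b \in B -> I (f * b).
  by move=> bB; apply/CI; exists b, 0; rewrite idealr0 addr0.
(* If f = f b + a, then f (1 - b) is in A, so 1 - b is in A and hence in B, and B would contain
   1. *)
have nIf : ~ I f.
  move=> /CI[b [a [bB aA ef]]]; have : 1 - b \in A.
    by rewrite -fnz mulrBl mul1r mulrC {1}ef addrAC subrr add0r.
  by move=> /AB h1; have := rpredD h1 bB; rewrite subrK idealr1.
have [mu mu_f nmu] : exists2 mu, mu \in msupp f &
    forall t, t \in triples -> ~~ (triple_mon t <= mu)%MM.
  apply: contrapT => hf; apply: nIf; rewrite (mpolyE f) big_seq.
  apply: ideal_sum => // m mf; rewrite -mul_mpolyC; apply: idealM => //.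
  apply: contrapT => nIm; apply: hf; exists m => // t tT; apply/negP => le_tm.
  by apply: nIm; apply: mpolyX_ideal_gen le_tm; apply: map_f.
have I_supp p m : I p -> m \in msupp p ->
    exists2 t, t \in triples & (triple_mon t <= m)%MM.
  by move=> Ip mp; have [_ /mapP[t tT ->] le_tm] := msupp_ideal_gen Ip mp; exists t.
(* As B is monomial, it contains X^u itself. Then f X^u lies in the monomial ideal I, and u + mu is
   in its support. *)
have B_supp b u : b \in B -> u \in msupp b ->
    exists2 t, t \in triples & (triple_mon t <= u + mu)%MM.
  move=> /Bms Bb ub; have [v vms le_vu] := msupp_ideal_gen Bb ub.
  have /fBI/I_supp : 'X_[u] \in B by apply/Bms; apply: mpolyX_ideal_gen le_vu.
  by apply; rewrite (perm_mem (msuppMX _ _)); apply: map_f.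
have [t0 t0T t0mu] := disjoint_triple nmu.
have [P PV] := var_prime_exists rat (fun i : 'I_6 => 0 < occ t0 i)%N.
(* A triple dividing u + mu meets t0, where mu vanishes, so u involves a variable of t0. *)
have BP : {subset B <= P}.
  move=> b bB; apply/PV => u hu; apply: memN_msupp_eq0; apply/negP => ub.
  have [t tT /mnm_lepP le_t] := B_supp b u bB ub.
  have [i /andP[ti t0i]] := triples_meet tT t0T.
  by have := le_t i; rewrite mnmDE hu // t0mu // triple_monE // leqNgt ti.
pose pi : {rmorphism S -> {ideal_quot A}} := \pi_{ideal_quot A}.
have pi_surj q : exists x, pi x = q by exists (repr q); apply: reprK.
have pi_ker x : pi x = 0 <-> x \in A.
  rewrite -(rmorph0 pi) -{2}(subr0 x) Quotient.idealrBE.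
  by split=> [e|/eqP//]; apply/eqP.
have mpA : max_principle (fun x => x \in A).
  by apply: noetherian_max_principle pi_surj pi_ker _; case: CM.
have [Q [AQ QP nPQ]] := prime_between mpA umA hA hB AB BP.
(* Three variables lie outside t0, so the chain from Q has length 3 + 1 = 4. *)
have [c []] := var_prime_chain PV QP nPQ; rewrite triple_compl // => c0 cS c4.
have reg : has_regular (fun x => x \in c 4%N) 4 (fun x => x \in A).
  apply: (cohen_macaulay_has_regular pi_surj pi_ker CM _ cS); rewrite ?c0 // => x nx.
  have x0 : x@_0%MM != 0 by apply: contra nx => /eqP/c4.
  exists ((x@_0%MM)^-1)%:MP; apply/c4.
  by rewrite mcoeffB mcoeff1 eqxx mcoeffCM mulVf ?subrr.
have mw t : moment_form 6 t \in c 4%N by apply/c4; apply: moment_form_mcoeff0.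
have w_span J : is_ideal J -> forall ts, uniq ts -> size ts = 6 ->
    (forall t, t \in ts -> J (moment_form 6 t)) -> forall z, z \in c 4%N -> J z.
  by move=> iJ ts uts sz Jts z /c4; apply: moment_forms_span uts sz Jts z.
have [ts [sz uts _ regA]] :=
  generic_regular_list mpA mw w_span [::] (idealr_is_ideal A) (fun x => id) reg.
set ls := map _ ts in regA.
pose L := combination ls (fun=> True).
have iL : is_ideal L by apply: combination_ideal.
have Lts t : t \in ts -> L (moment_form 6 t).
  by move=> tts; apply: mem_combination; apply: map_f.
(* mu is not 1, because f has degree d > 0. *)
have [i0 mui0] : exists i, (0 < mu i)%N.
  apply: contrapT => nmui; have mu0 : mu = 0%MM.
    apply/mnmP => i; rewrite mnm0E; apply/eqP; rewrite -leqn0 leqNgt.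
    by apply/negP => mui; apply: nmui; exists i.
  by move: d0; rewrite -(dhomog_mf fd mu_f) mu0 /= mdeg0.
have [g hg] := triples_containing i0.
pose tr (j : 'I_10) := nth (0, 0, 0)%N triples j.
have trT j : tr j \in triples by apply: mem_nth.
have /choice [b hb] j : exists b, exists2 a, a \in A &
    b \in B /\ 'X_[triple_mon (tr j)] = f * b + a.
  have /CI[b [a [bB aA e]]] : I 'X_[triple_mon (tr j)]; last by exists b, a.
  by apply: mpolyX_ideal_gen (lepm_refl _); apply: map_f.
have /choice [N hN] j := cubic_reduce (tr j) iL uts sz Lts.
(* Column q is the coefficient at the monomial whose product with mu is the triple [g q]. If mu does
   not divide that triple, the truncated difference is another monomial and the column one more
   linear condition. *)
pose M1 : 'M[rat]_(10, 5) := \matrix_(j, q) (b j)@_(triple_mon (g q) - mu).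
pose M2 : 'M[rat]_(10, 4) := \matrix_(j, k) N j k.
have [v v0] := exists_left_kernel (row_mx M1 M2) isT.
rewrite mul_mx_row -row_mx0 => /eq_row_mx[/rowP vM1 /rowP vM2].
pose p : S := \sum_j (v 0 j)%:MP * 'X_[triple_mon (tr j)].
pose bs : S := \sum_j (v 0 j)%:MP * b j.
have bsB : bs \in B by apply: rpred_sum => j _; apply: idealMr; case: (hb j) => a _ [].
have p_fbs : p - f * bs \in A.
  rewrite mulr_sumr -sumrB; apply: rpred_sum => j _.
  have [a aA [_ ->]] := hb j.
  by rewrite (_ : _ - _ = (v 0 j)%:MP * a) ?idealMr //; ring.
have Lp : L p.
  rewrite -(subr0 p).
  have <- : \sum_j (v 0 j)%:MP * \sum_(k < 4) (N j k)%:MP *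
      ('X_(inord 4) ^+ k * 'X_(inord 5) ^+ (3 - k)) = 0 :> S.
    under eq_bigr do rewrite mulr_sumr.
    rewrite exchange_big big1 //= => k _.
    transitivity ((\sum_j v 0 j * N j k)%:MP *
        ('X_(inord 4) ^+ k * 'X_(inord 5) ^+ (3 - k)) : S).
      by rewrite rmorph_sum mulr_suml; apply: eq_bigr => j _; rewrite /= mpolyCM -mulrA.
    have := vM2 k; rewrite !mxE => h0.
    rewrite (_ : \sum_(i < 10) _ = 0) ?mpolyC0 ?mul0r // -[RHS]h0.
    by apply: eq_bigr => j _; rewrite mxE.
  by rewrite -sumrB; apply: ideal_sum => // j _; rewrite -mulrBr; apply: idealM.
(* In that degree u + mu is divisible by a triple of the same degree 3, hence equals it. The triple
   contains i0, so it is some [g q], and [vM1] kills the coefficient. The sum avoids the truncated 3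
   - d. *)
have bs_supp u : u \in msupp bs -> (mdeg u + d)%N <> 3.
  move=> ubs e3; have [t tT le_t] := B_supp _ _ bsB ubs.
  have et : (u + mu)%MM = triple_mon t.
    rewrite -(submK le_t); set w := (_ - _)%MM.
    suff -> : w = 0%MM by rewrite add0m.
    apply/eqP; rewrite -mdeg_eq0; have := congr1 mdeg (submK le_t).
    rewrite -/w mdegD mdeg_triple_mon mdegD (dhomog_mf fd mu_f) e3 => /eqP.
    by rewrite -[X in _ == X]add0n eqn_add2r.
  have [|q tq] := hg t tT.
    by rewrite -triple_monE // -et mnmDE (leq_trans mui0) // leq_addl.
  move: ubs; rewrite mcoeff_msupp => /eqP; apply.
  rewrite -(addmK mu u) et tq; have := vM1 q; rewrite !mxE => h0.
  rewrite raddf_sum -[RHS]h0; apply: eq_bigr => j _.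
  by rewrite /= mcoeffCM mxE.
(* f bs has no part of degree 3, so p is the degree 3 component of p - f bs, an element of the
   homogeneous ideal A. *)
have pA : p \in A.
  suff <- : pihomog mdeg 3 (p - f * bs) = p by apply: homA.
  rewrite pihomogB [X in _ - X]pihomogE big1_seq ?subr0 => [|m /andP[/eqP em mfb]].
    apply: pihomog_dE; apply: rpred_sum => j _; rewrite mul_mpolyC.
    by apply: rpredZ; rewrite dhomogX; apply/eqP/mdeg_triple_mon.
  have /allpairsP[[m1 m2] /= [m1f m2b e]] := msuppM_le mfb.
  by case: (bs_supp m2 m2b); rewrite -(dhomog_mf fd m1f) -mdegD addmC -e.
have p0 := regular_list_cap (idealr_is_ideal A) regA pA Lp.
(* A lies in I and so starts in degree 3; the linear forms raise this to 4. *)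
have p_low : forall u, (mdeg u < 4)%N -> p@_u = 0.
  apply: (mcoeff_combination_low _ _ p0) => [l /mapP[t _ ->]|a aA u lt_u].
    exact: moment_form_mcoeff0.
  apply: memN_msupp_eq0; apply/negP => ua.
  have [t _ /submK eu] := I_supp _ _ (AI a aA) ua.
  by move: lt_u; rewrite -eu mdegD mdeg_triple_mon ltnNge leq_addl.
(* The ten monomials are distinct, so the coefficient of p at the j-th one is v_j. *)
move/rV0Pn: v0 => [j]; apply/negP; rewrite negbK; apply/eqP.
have := p_low (triple_mon (tr j)); rewrite mdeg_triple_mon => /(_ isT) <-.
rewrite raddf_sum (bigD1 j) //= mcoeffCM mcoeffX eqxx mulr1 big1 ?addr0 // => k ne_kj.
rewrite mcoeffCM mcoeffX; case: eqP => [e|]; last by rewrite mulr0.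
have /eqP := triple_mon_inj (trT k) (trT j) e.
by rewrite nth_uniq // val_eqE (negPf ne_kj).
Qed.
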